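(* Let $G$ be the digraph with $V(G)=\{v,w\}$ (two distinct vertices) and $E(G)=\{(v,v),(v,w)\}$. Then the associative spectrum of its graph algebra is $s_n(\mathbb{A}(G))=2^{n-2}$ for all $n\ge 2$.
   Context: Graph algebra of a digraph $G=(V,E)$: $\mathbb{A}(G)=(V\cup\{\infty\};\circ,\infty)$ with $\infty\notin V$, where $x\circ y=x$ if $(x,y)\in E$ and $x\circ y=\infty$ otherwise. $B_n$ is the set of bracketings of size $n$: groupoid terms obtained from the string $x_1x_2\cdots x_n$ of distinct variables (in this order) by inserting parentheses so that the product is unambiguous. $s_n(\mathbb{A}(G))$ is the number of distinct $n$-ary operations on $V\cup\{\infty\}$ induced by the elements of $B_n$; the sequence $(s_n)_{n\ge1}$ is the associative spectrum. *)

(* Defs.v *)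
From mathcomp Require Import all_boot.
From mathcomp Require Import boolp.

Set Implicit Arguments.
Unset Strict Implicit.
Unset Printing Implicit Defensive.

Inductive term (X : Type) : Type :=
| Var of X
| Mul of term X & term X.

Fixpoint vars (X : Type) (t : term X) : seq X :=
  match t with
  | Var x => [:: x]
  | Mul t1 t2 => vars t1 ++ vars t2
  end.

Fixpoint eval (X A : Type) (op : A -> A -> A) (e : X -> A) (t : term X) : A :=
  match t with
  | Var x => e x
  | Mul t1 t2 => op (eval op e t1) (eval op e t2)
  end.

(* The variables x_1, ..., x_n are the elements of 'I_n. A bracketing is a term
   that becomes the string x_1 x_2 ... x_n once its parentheses are erased. *)
Definition bracketing (n : nat) (t : term 'I_n) : Prop := vars t = enum 'I_n.

Definition term_op (A : finType) (op : A -> A -> A) (n : nat) (t : term 'I_n) :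
  {ffun n.-tuple A -> A} := [ffun a : n.-tuple A => eval op (tnth a) t].

Definition spectrum (A : finType) (op : A -> A -> A) (n : nat) : nat :=
  #|[set f : {ffun n.-tuple A -> A} |
      `[< exists t : term 'I_n, bracketing t /\ f = term_op op t >]]|.

(* The carrier of the graph algebra is [option V], with [None] as infinity. *)
Definition graph_op (V : Type) (E : rel V) (x y : option V) : option V :=
  match x, y with
  | Some a, Some b => if E a b then Some a else None
  | _, _ => None
  end.

(* Main.v *)
Require Import Defs.
From mathcomp Require Import all_boot.
From mathcomp Require Import boolp.

Set Implicit Arguments.
Unset Strict Implicit.
Unset Printing Implicit Defensive.

(** Every edge of this digraph starts at [v], and [v] has an edge to every
    vertex: hence [x o y] is [v] if [x] is [v] and [y] is finite, and is
    infinity otherwise ([graph_op_tail]). Evaluating a product therefore imposes a constraint on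
    each variable separately. A variable that is itself the right factor of
    some product only has to be finite; every other variable is the left
    factor of a product and has to equal [v] ([eval_roles]). So a bracketing
    of size at least 2 induces the operation that takes the value [v] or
    infinity according to these constraints, and the operation is encoded by
    the sequence of bits (the roles) that tells which variables are forced to
    be [v].

    The first variable is always forced and the last one never is
    ([roles_split]). The [n - 2] bits in between are arbitrary, as shown by an
    explicit bracketing ([roles_comb]), and they can be read off from the
    operation by assigning [v] to the forced variables and [w] to the others
    ([role_op_inj]). Hence there are [2 ^ (n - 2)] operations. *)

Lemma all2_cat (S T : Type) (r : S -> T -> bool) s1 s2 t1 t2 :
  size s1 = size t1 -> all2 r (s1 ++ s2) (t1 ++ t2) = all2 r s1 t1 && all2 r s2 t2.
Proof. by elim: s1 t1 => [|x s1 IH] [|y t1] //= [/IH->]; rewrite andbA. Qed.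

Section Roles.
Variable X : Type.
Implicit Types (t acc : term X) (b : bool).

(** The parameter [b] carries the side on which the current subterm stands in
    its parent down to the variables; at the root it only matters when the
    whole term is a variable. *)
Fixpoint roles b t : seq bool :=
  match t with
  | Var _ => [:: b]
  | Mul t1 t2 => roles true t1 ++ roles false t2
  end.

Lemma size_roles b t : size (roles b t) = size (vars t).
Proof. by elim: t b => [//|t1 IH1 t2 IH2] b /=; rewrite !size_cat IH1 IH2. Qed.

Lemma roles_context b b' t : 1 < size (vars t) -> roles b t = roles b' t.
Proof. by case: t. Qed.

Lemma roles_true_head t : exists s, roles true t = true :: s.
Proof.
elim: t => [x|t1 [s IH1] t2 _]; first by exists [::].
by exists (s ++ roles false t2); rewrite /= IH1.
Qed.

Lemma roles_false_last t : exists s, roles false t = rcons s false.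
Proof.
elim: t => [x|t1 _ t2 [s IH2]]; first by exists [::].
by exists (roles true t1 ++ s); rewrite /= IH2 rcons_cat.
Qed.

Lemma roles_split b t : 1 < size (vars t) ->
  exists s, roles b t = true :: rcons s false.
Proof.
case: t => // t1 t2 _ /=.
have [s1 ->] := roles_true_head t1; have [s2 ->] := roles_false_last t2.
by exists (s1 ++ s2); rewrite rcons_cat.
Qed.

(** A bracketing with prescribed roles. A variable that must be a right factor
    is multiplied at once to the term accumulated on its left; a variable that
    must be a left factor starts a new accumulator, which gathers everything
    to its right. *)
Fixpoint comb acc (s : seq (X * bool)) : term X :=
  match s with
  | [::] => acc
  | (x, true) :: s' => Mul acc (comb (Var x) s')
  | (x, false) :: s' => comb (Mul acc (Var x)) s'
  end.

Lemma vars_comb acc s : vars (comb acc s) = vars acc ++ unzip1 s.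
Proof.
elim: s acc => [|[x []] s IH] acc /=; first by rewrite cats0.
  by rewrite IH.
by rewrite IH /= -catA.
Qed.

(** The last variable cannot be a left factor, hence the hypothesis on the
    last bit. *)
Lemma roles_comb acc s :
  ~~ last false (unzip2 s) -> roles true (comb acc s) = roles true acc ++ unzip2 s.
Proof.
elim: s acc => [|[x []] s IH] acc /=; first by rewrite cats0.
  case: s IH => [//|p s] IH last_s.
  rewrite (@roles_context false true); last by rewrite vars_comb.
  by rewrite IH.
by move=> last_s; rewrite IH //= -catA.
Qed.

End Roles.

Section Operation.
Variables (V : eqType) (v : V).
Implicit Types (x y : option V) (b : bool).

Definition admits b x : bool := if b then x == Some v else x != None.

(** A product is finite exactly when it is [v], so a constraint on it splits
    into the strong one on its left factor and the weak one on its right factor,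
    whichever of the two constraints it was. *)
Lemma eval_roles (op : option V -> option V -> option V) (X : Type)
    (e : X -> option V) b (t : term X) :
  (forall x y, op x y = if (x == Some v) && (y != None) then Some v else None) ->
  admits b (eval op e t) = all2 admits (roles b t) (map e (vars t)).
Proof.
move=> opE; elim: t b => [x|t1 IH1 t2 IH2] b /=; first by rewrite andbT.
rewrite map_cat all2_cat ?size_roles ?size_map // -IH1 -IH2 opE /admits.
by case: b; case: (_ && _); rewrite ?eqxx.
Qed.

Lemma all2_admits_implb (w : V) (s s' : seq bool) : w != v ->
  all2 admits s [seq Some (if b then v else w) | b <- s'] = all2 implb s s'.
Proof.
move=> wv; elim: s s' => [|b s IH] [|b' s'] //=; rewrite IH; congr (_ && _).
rewrite /admits; case: b b' => [] [] //=; first exact: eqxx.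
by apply: negbTE; apply: contraNneq wv => -[->].
Qed.

End Operation.

Lemma all2_implb_anti (s s' : seq bool) :
  all2 implb s s' -> all2 implb s' s -> s = s'.
Proof.
elim: s s' => [|b s IH] [|b' s'] //= /andP[bb' ss'] /andP[b'b s's].
by rewrite (IH s') //; case: b b' bb' b'b => [] [].
Qed.

Definition role_op (V : finType) (v : V) (n : nat) (s : seq bool) :
    {ffun n.-tuple (option V) -> option V} :=
  [ffun a : n.-tuple (option V) => if all2 (admits v) s a then Some v else None].

(** A role sequence is admitted by the assignment of [v] and [w] that it
    prescribes, and by those prescribed by sequences with more forced bits. *)
Lemma role_op_inj (V : finType) (v w : V) (n : nat) (s s' : seq bool) :
  w != v -> size s = n -> size s' = n ->
  role_op v n s = role_op v n s' -> s = s'.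
Proof.
move=> wv.
have implb_refl (r : seq bool) : all2 implb r r by elim: r => //= -[].
have half r r' : size r = n -> role_op v n r = role_op v n r' -> all2 implb r' r.
  move=> szr.
  have sza : size [seq Some (if b then v else w) | b <- r] == n by rewrite size_map szr.
  move=> /ffunP/(_ (Tuple sza)); rewrite !ffunE /= !all2_admits_implb // implb_refl.
  by case: ifP.
move=> szs szs' eq_op; apply: all2_implb_anti.
  exact: half szs' (esym eq_op).
exact: half szs eq_op.
Qed.

Section Spectrum.
Variables (V : finType) (v : V) (op : option V -> option V -> option V).
Hypothesis opE : forall x y,
  op x y = if (x == Some v) && (y != None) then Some v else None.

Lemma term_op_roles (n : nat) (t : term 'I_n) : 1 < n -> bracketing t ->
  term_op op t = role_op v n (roles true t).
Proof.
move=> n_gt1 vt; apply/ffunP => a; rewrite !ffunE.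
have := eval_roles (tnth a) true t opE.
rewrite vt map_tnth_enum /= => <-.
(* A term of size at least 2 is a product, so its value is [v] or infinity. *)
case: t vt => [x /(congr1 size)|t1 t2 _ /=].
  by rewrite size_enum_ord /= => n1; rewrite -n1 in n_gt1.
by rewrite opE; case: ifP => //= _; rewrite eqxx.
Qed.

Lemma bracketing_of_roles (n : nat) (c : (n - 2).-tuple bool) : 1 < n ->
  exists2 t : term 'I_n, bracketing t & roles true t = true :: rcons c false.
Proof.
move=> n_gt1; have := size_enum_ord n; rewrite /bracketing.
case: (enum 'I_n) => [|x xs] /= sz_xs; first by rewrite -sz_xs in n_gt1.
have sz : size xs = size (rcons c false).
  by apply: succn_inj; rewrite sz_xs size_rcons size_tuple -addn2 subnK.
exists (comb (Var x) (zip xs (rcons c false))).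
  by rewrite vars_comb unzip1_zip ?sz.
by rewrite roles_comb unzip2_zip ?sz // last_rcons.
Qed.

Lemma spectrum_tail (w : V) (n : nat) : w != v -> 1 < n ->
  spectrum op n = 2 ^ (n - 2).
Proof.
move=> wv n_gt1.
pose F (c : (n - 2).-tuple bool) := role_op v n (true :: rcons c false).
have sz (c : (n - 2).-tuple bool) : size (true :: rcons c false) = n.
  by rewrite /= size_rcons size_tuple -addn2 subnK.
have F_inj : injective F.
  move=> c c' /(role_op_inj wv (sz c) (sz c')) [] /rcons_inj [cc'].
  exact: val_inj.
have <- : #|F @: [set: (n - 2).-tuple bool]| = 2 ^ (n - 2).
  by rewrite card_imset // cardsT card_tuple card_bool.
apply: eq_card => f; rewrite inE; apply/asboolP/imsetP => [[t [vt ->]]|[c _ ->]].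
  have szt : size (vars t) = n by rewrite vt size_enum_ord.
  have [|c rt] := @roles_split _ true t; first by rewrite szt.
  have szc : size c == n - 2.
    by rewrite -[in n - 2]szt -(size_roles true) rt /= size_rcons !subSS subn0.
  by exists (Tuple szc); rewrite // term_op_roles // rt.
have [t vt rt] := bracketing_of_roles c n_gt1.
by exists t; split=> //; rewrite term_op_roles // rt.
Qed.

End Spectrum.

Lemma graph_op_tail (V : eqType) (v : V) (E : rel V) :
  (forall x y, E x y = (x == v)) ->
  forall x y, graph_op E x y = if (x == Some v) && (y != None) then Some v else None.
Proof.
move=> EE [x|] [y|] //=; last by rewrite andbF.
rewrite EE andbT; have [-> | xv] := eqVneq x v; first by rewrite eqxx.
by rewrite ifN //; apply: contraNneq xv => -[->].
Qed.

Unset Implicit Arguments.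

Theorem proposition5p7 (V : finType) (v w : V) (E : rel V)
    (hvw : v != w)
    (hV : [set: V] = [set v; w])
    (hE : forall x y : V, E x y = ((x, y) \in [set (v, v); (v, w)]))
    (n : nat) (hn : 2 <= n) :
  spectrum (graph_op E) n = 2 ^ (n - 2).
Proof.
have EE x y : E x y = (x == v).
  have : y \in [set v; w] by rewrite -hV inE.
  by rewrite hE !inE !xpair_eqE -andb_orr => ->; rewrite andbT.
apply: (spectrum_tail (graph_op_tail EE) (w := w)) => //.
by rewrite eq_sym.
Qed.
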